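(* Let $0<p\le 1$ and let $K\subseteq\mathbb{R}^n$ be a $p$-convex set. Then its topological closure $\overline{K}$ is also a $p$-convex set.
   Context: For $0<p\le 1$, a set $K\subseteq\mathbb{R}^n$ is called $p$-convex if $\lambda x+\mu y\in K$ for every $x,y\in K$ and all $\lambda,\mu\ge 0$ with $\lambda^p+\mu^p=1$. *)

(* Defs.v *)
From mathcomp Require Import all_boot all_order all_algebra.
From mathcomp Require Import all_classical all_reals all_analysis.

Set Implicit Arguments.
Unset Strict Implicit.
Unset Printing Implicit Defensive.

Import Order.TTheory GRing.Theory Num.Theory.
Import numFieldNormedType.Exports.

Local Open Scope classical_set_scope.
Local Open Scope ring_scope.

(* R^n is 'rV[R]_n.  For p != 0, powR satisfies 0 `^ p = 0, so the
   coefficient pairs (1, 0) and (0, 1) are admissible, as they should be. *)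
Definition p_convex (R : realType) (n : nat) (p : R) (K : set 'rV[R]_n) : Prop :=
  forall x y : 'rV[R]_n, K x -> K y ->
  forall lambda mu : R, 0 <= lambda -> 0 <= mu ->
    lambda `^ p + mu `^ p = 1 -> K (lambda *: x + mu *: y).

(* Main.v *)
Require Import Defs.
From mathcomp Require Import all_boot all_order all_algebra.
From mathcomp Require Import all_classical all_reals all_analysis.
Import Order.TTheory GRing.Theory Num.Theory.
Import numFieldNormedType.Exports.
Local Open Scope classical_set_scope.
Local Open Scope ring_scope.

Theorem corollary4p2 (R : realType) (n : nat) (p : R) (hp0 : 0 < p) (hp1 : p <= 1)
  (K : set 'rV[R]_n) (hK : p_convex p K) : p_convex p (closure K).
Proof.
move=> x y clKx clKy lambda mu lambda_ge0 mu_ge0 lambda_mu B nbhsB.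
have comb_cvg : lambda *: z.1 + mu *: z.2 @[z --> (x, y)] -->
    lambda *: x + mu *: y.
  by apply: cvgD; apply: cvgZr; [exact: cvg_fst | exact: cvg_snd].
have [[U V] [/= nbhsU nbhsV] UVB] := comb_cvg _ nbhsB.
have [u [Ku Uu]] := clKx _ nbhsU.
have [v [Kv Vv]] := clKy _ nbhsV.
exists (lambda *: u + mu *: v); split; first exact: hK.
exact: (UVB (u, v)).
Qed.
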